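(* Let $(X,\mathcal{T})$ be an infra topological space and let $A\subseteq X$. Then: (i) $A$ is infra $e^*$-open if and only if $A=A\cap \mathrm{Cl}(\mathrm{Int}(\mathrm{Cl}_\delta(A)))$; (ii) $A$ is infra $e^*$-closed if and only if $A=A\cup \mathrm{Int}(\mathrm{Cl}(\mathrm{Int}_\delta(A)))$; (iii) $e^*\mathrm{Cl}(A)=A\cup \mathrm{Int}(\mathrm{Cl}(\mathrm{Int}_\delta(A)))$; (iv) $e^*\mathrm{Int}(A)=A\cap \mathrm{Cl}(\mathrm{Int}(\mathrm{Cl}_\delta(A)))$.
   Context: An infra topological space $(X,\mathcal{T})$ is a set $X$ with a family $\mathcal{T}$ of subsets of $X$ such that $\emptyset,X\in\mathcal{T}$ and $\mathcal{T}$ is closed under finite intersections (closure under unions is not required). Members of $\mathcal{T}$ are called infra open; their complements are infra closed. For $A\subseteq X$: $\mathrm{Int}(A)=\bigcup\{O: O\subseteq A,\ O\in\mathcal{T}\}$ and $\mathrm{Cl}(A)=\bigcap\{C: A\subseteq C,\ X\setminus C\in\mathcal{T}\}$. A set $A$ is infra regular open if $A=\mathrm{Int}(\mathrm{Cl}(A))$. Put $\mathrm{Int}_\delta(A)=\bigcup\{O: O\subseteq A,\ O \text{ infra regular open}\}$ and $\mathrm{Cl}_\delta(A)=\bigcap\{C: A\subseteq C,\ X\setminus C \text{ infra regular open}\}$. A set $A$ is infra $e^*$-open if $A\subseteq \mathrm{Cl}(\mathrm{Int}(\mathrm{Cl}_\delta(A)))$, and infra $e^*$-closed if $X\setminus A$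 is infra $e^*$-open. $e^*\mathrm{Cl}(A)$ is the intersection of all infra $e^*$-closed sets containing $A$; $e^*\mathrm{Int}(A)$ is the union of all infra $e^*$-open sets contained in $A$. *)

(* Defs.v *)
From mathcomp Require Import all_boot.
From mathcomp Require Import classical_sets.

Set Implicit Arguments.
Unset Strict Implicit.
Unset Printing Implicit Defensive.

Local Open Scope classical_set_scope.

(* Closure under unions is not required, so [infra_int T A] below need not
   belong to [T]. *)
Record infra_topology (X : Type) (T : set (set X)) : Prop := InfraTopology {
  infra_open0 : T set0;
  infra_openT : T setT;
  infra_openI : setI_closed T }.

Definition infra_int (X : Type) (T : set (set X)) (A : set X) : set X :=
  \bigcup_(O in [set O : set X | O `<=` A /\ T O]) O.

Definition infra_cl (X : Type) (T : set (set X)) (A : set X) : set X :=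
  \bigcap_(C in [set C : set X | A `<=` C /\ T (~` C)]) C.

(* Not required to belong to [T]. *)
Definition infra_regular_open (X : Type) (T : set (set X)) (A : set X) : Prop :=
  A = infra_int T (infra_cl T A).

Definition int_delta (X : Type) (T : set (set X)) (A : set X) : set X :=
  \bigcup_(O in [set O : set X | O `<=` A /\ infra_regular_open T O]) O.

Definition cl_delta (X : Type) (T : set (set X)) (A : set X) : set X :=
  \bigcap_(C in [set C : set X | A `<=` C /\ infra_regular_open T (~` C)]) C.

Definition estar_open (X : Type) (T : set (set X)) (A : set X) : Prop :=
  A `<=` infra_cl T (infra_int T (cl_delta T A)).

Definition estar_closed (X : Type) (T : set (set X)) (A : set X) : Prop :=
  estar_open T (~` A).

Definition estar_cl (X : Type) (T : set (set X)) (A : set X) : set X :=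
  \bigcap_(C in [set C : set X | estar_closed T C /\ A `<=` C]) C.

Definition estar_int (X : Type) (T : set (set X)) (A : set X) : set X :=
  \bigcup_(O in [set O : set X | estar_open T O /\ O `<=` A]) O.

(* Main.v *)
(** The only real content is that [A `&` Cl (Int (Cl_delta A))] is e*-open;
    the statements on closed sets follow by complementation.  Let
    [B := A `&` Cl (Int (Cl_delta A))], let [O] be open with
    [O `<=` Cl_delta A], and let [R] be a regular open neighbourhood of a point
    of [O].  Then [W := Int (Cl O)] is regular open, hence so is [W `&` R],
    which therefore meets [A]; since [W `<=` Cl O `<=` Cl (Int (Cl_delta A))],
    it meets [B], so [R] meets [B].  Thus [O `<=` Cl_delta B], which gives
    [Int (Cl_delta A) `<=` Int (Cl_delta B)]. *)

Require Import Defs.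
From mathcomp Require Import all_boot.
From mathcomp Require Import boolp classical_sets.

Local Open Scope classical_set_scope.

Section InfraTopology.
Context {X : Type} (T : set (set X)).
Implicit Types A B O R : set X.

Lemma infra_intS A B : A `<=` B -> infra_int T A `<=` infra_int T B.
Proof. by move=> AB x [O [OA TO] Ox]; exists O => //; split=> // y /OA /AB. Qed.

Lemma infra_int_sub A : infra_int T A `<=` A.
Proof. by move=> x [O [OA _]] /OA. Qed.

Lemma infra_open_sub_int O A : T O -> O `<=` A -> O `<=` infra_int T A.
Proof. by move=> TO OA x Ox; exists O. Qed.

(** An interior need not lie in [T], but every open subset of [A] is contained in it, so both unions
    run over the same open sets. *)
Lemma infra_int_idem A : infra_int T (infra_int T A) = infra_int T A.
Proof.
apply/seteqP; split; first exact: infra_int_sub.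
by move=> x [O [OA TO] Ox]; exists O => //; split=> //; exact: infra_open_sub_int.
Qed.

Lemma infra_clS A B : A `<=` B -> infra_cl T A `<=` infra_cl T B.
Proof. by move=> AB x clA C [BC TC]; apply: clA; split=> // y /AB /BC. Qed.

Lemma sub_infra_cl A : A `<=` infra_cl T A.
Proof. by move=> x Ax C [+ _]; exact. Qed.

Lemma infra_cl_idem A : infra_cl T (infra_cl T A) = infra_cl T A.
Proof.
apply/seteqP; split; last exact: sub_infra_cl.
by move=> x clA C [AC TC]; apply: clA; split=> // y; apply; split.
Qed.

Lemma infra_intC A : infra_int T (~` A) = ~` infra_cl T A.
Proof.
rewrite /infra_int /infra_cl setC_bigcap; apply/seteqP; split=> x.
  move=> [O [OA TO] Ox]; exists (~` O) => /=; last exact.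
  by rewrite setCK; split=> //; apply/subsetCr.
by move=> [C [AC TC] Cx]; exists (~` C) => //=; split=> //; apply: subsetC.
Qed.

Lemma infra_clC A : infra_cl T (~` A) = ~` infra_int T A.
Proof. by rewrite -[in RHS](setCK A) infra_intC setCK. Qed.

Lemma int_deltaC A : int_delta T (~` A) = ~` cl_delta T A.
Proof.
rewrite /int_delta /cl_delta setC_bigcap; apply/seteqP; split=> x.
  move=> [O [OA TO] Ox]; exists (~` O) => /=; last exact.
  by rewrite setCK; split=> //; apply/subsetCr.
by move=> [C [AC TC] Cx]; exists (~` C) => //=; split=> //; apply: subsetC.
Qed.

Lemma cl_deltaC A : cl_delta T (~` A) = ~` int_delta T A.
Proof. by rewrite -[in RHS](setCK A) int_deltaC setCK. Qed.

Lemma cl_deltaS A B : A `<=` B -> cl_delta T A `<=` cl_delta T B.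
Proof. by move=> AB x clA C [BC rC]; apply: clA; split=> // y /AB /BC. Qed.

(** Otherwise the complement of [R] is one of the sets intersected in [cl_delta T A], and it misses
    [x]. *)
Lemma cl_delta_meets A R x :
  infra_regular_open T R -> R x -> cl_delta T A x -> A `&` R !=set0.
Proof.
move=> rR Rx clx; apply/set0P/eqP => AR0.
by apply: (clx (~` R)) => //; rewrite /= setCK; split=> //; exact/disjoints_subset.
Qed.

Lemma infra_regular_open_int_cl O :
  T O -> infra_regular_open T (infra_int T (infra_cl T O)).
Proof.
move=> TO; apply/seteqP; split.
  by rewrite -{1}infra_int_idem; apply: infra_intS; exact: sub_infra_cl.
by apply: infra_intS; rewrite -{2}(infra_cl_idem O); apply: infra_clS;
  exact: infra_int_sub.
Qed.

Hypothesis hT : infra_topology T.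

Lemma infra_intI A B : infra_int T A `&` infra_int T B `<=` infra_int T (A `&` B).
Proof.
move=> x [[O [OA TO] Ox] [O' [OB TO'] O'x]]; exists (O `&` O') => //.
by split; [exact: setISS | exact: (infra_openI hT)].
Qed.

(** Regular open sets are fixed by Int, so [infra_intI] gives one inclusion; monotonicity of Int Cl
    gives the other. *)
Lemma infra_regular_openI R R' : infra_regular_open T R ->
  infra_regular_open T R' -> infra_regular_open T (R `&` R').
Proof.
move=> rR rR'; apply/seteqP; split.
  have intR Q : infra_regular_open T Q -> infra_int T Q = Q.
    by move=> rQ; rewrite rQ infra_int_idem.
  move=> x; rewrite -{1}(intR _ rR) -{1}(intR _ rR') => /infra_intI.
  by apply: infra_intS; exact: sub_infra_cl.
move=> x RR'x; split.
  by rewrite rR; move: x RR'x; apply: infra_intS; apply: infra_clS => y [].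
by rewrite rR'; move: x RR'x; apply: infra_intS; apply: infra_clS => y [].
Qed.

Lemma estar_open_setI_cl_int A :
  estar_open T (A `&` infra_cl T (infra_int T (cl_delta T A))).
Proof.
set B := A `&` _.
(* [B] lies in Cl (Int (Cl_delta A)) by construction, so monotonicity of Cl reduces the claim to
   interiors. *)
suff sub : infra_int T (cl_delta T A) `<=` infra_int T (cl_delta T B).
  by move=> x [_]; exact: infra_clS.
move=> x [O [OA TO] Ox]; exists O => //; split=> // y Oy C [BC rC].
(* If [y] is outside [C], the complement of [C] serves as the regular open neighbourhood of [y]. *)
apply: contrapT => Cy.
have Wy : infra_int T (infra_cl T O) y.
  by move: y Oy {Cy}; apply: infra_open_sub_int => //; exact: sub_infra_cl.
have [a [Aa [Wa Ca]]] := cl_delta_meets _ _ _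
  (infra_regular_openI _ _ (infra_regular_open_int_cl _ TO) rC)
  (conj Wy Cy) (OA _ Oy).
(* The point [a] lies in [B], hence in [C], against [Ca]. *)
apply/Ca/BC; split=> //; move/infra_int_sub: Wa; apply: infra_clS.
exact: infra_open_sub_int.
Qed.

Lemma estar_openE A :
  estar_open T A <-> A = A `&` infra_cl T (infra_int T (cl_delta T A)).
Proof. by split=> [eA|/esym/setIidPl]; first exact/esym/setIidPl. Qed.

(** By monotonicity the right side contains every e*-open subset of [A], and it is itself one of
    them. *)
Lemma estar_intE A :
  estar_int T A = A `&` infra_cl T (infra_int T (cl_delta T A)).
Proof.
apply/seteqP; split=> x.
  move=> [O [eO OA] Ox]; split; first exact: OA.
  by move/eO: Ox; apply: infra_clS; apply: infra_intS; exact: cl_deltaS.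
move=> Bx; exists (A `&` infra_cl T (infra_int T (cl_delta T A))) => //.
by split; [exact: estar_open_setI_cl_int | exact: subIsetl].
Qed.

Lemma setC_setI_cl_int A :
  ~` (~` A `&` infra_cl T (infra_int T (cl_delta T (~` A)))) =
  A `|` infra_int T (infra_cl T (int_delta T A)).
Proof. by rewrite cl_deltaC infra_intC infra_clC setCI !setCK. Qed.

(** Complementation exchanges the e*-closed supersets of [A] with the e*-open subsets of its
    complement, so this is dual to [estar_intE]. *)
Lemma estar_clE A :
  estar_cl T A = A `|` infra_int T (infra_cl T (int_delta T A)).
Proof.
rewrite -setC_setI_cl_int -estar_intE /estar_int setC_bigcup.
apply/seteqP; split=> x clA C [eC AC].
  by apply: clA; rewrite /estar_closed /= setCK; split=> //; apply/subsetCr.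
by rewrite -[C]setCK; apply: clA; split=> //; exact: subsetC.
Qed.

End InfraTopology.

Theorem theorem3p23 (X : Type) (T : set (set X)) (hT : infra_topology T)
    (A : set X) :
  (estar_open T A <-> A = A `&` infra_cl T (infra_int T (cl_delta T A))) /\
  (estar_closed T A <-> A = A `|` infra_int T (infra_cl T (int_delta T A))) /\
  estar_cl T A = A `|` infra_int T (infra_cl T (int_delta T A)) /\
  estar_int T A = A `&` infra_cl T (infra_int T (cl_delta T A)).
Proof.
split; first exact: estar_openE.
split; last by split; [exact: estar_clE | exact: estar_intE].
(* Part (ii) is part (i) for the complement of [A], with both sides of the equation complemented. *)
apply: (iff_trans (estar_openE T (~` A))); rewrite -setC_setI_cl_int.
by split=> [<-|{1}->]; rewrite setCK.
Qed.
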